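(* Let $E:=[a,b]\subset\mathbb R$ with $a<b$, let $g\in C^{(2)}(E)$, let $\mathbf x=(x_1,\dots,x_n)$ with all $x_i\in E$, and let $\mathbf p=(p_1,\dots,p_n)$ with $p_i>0$ and $\sum_{i=1}^n p_i=1$. Then $$\frac12\, m_g(E)\, J_n(\mathbf p,\mathbf x;x^2)\le J_n(\mathbf p,\mathbf x;g)\le \frac12\, M_g(E)\, J_n(\mathbf p,\mathbf x;x^2),$$ where $m_g(E):=\min_{t\in E}g''(t)$ and $M_g(E):=\max_{t\in E}g''(t)$.
   Context: $J_n(\mathbf p,\mathbf x;f):=\sum_{i=1}^n p_i f(x_i)-f\bigl(\sum_{i=1}^n p_i x_i\bigr)$ is the Jensen functional; in particular $J_n(\mathbf p,\mathbf x;x^2)=\sum_{i=1}^n p_i x_i^2-\bigl(\sum_{i=1}^n p_i x_i\bigr)^2$. *)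

(* Defs.v *)
From HB Require Import structures.
From mathcomp Require Import all_boot all_order all_algebra.
From mathcomp Require Import all_classical all_reals all_analysis.

Set Implicit Arguments.
Unset Strict Implicit.
Unset Printing Implicit Defensive.

Import Order.TTheory GRing.Theory Num.Theory.
Import numFieldNormedType.Exports.

Local Open Scope classical_set_scope.
Local Open Scope ring_scope.

(* Calculus relative to a set E: the difference quotient at x is only taken
   over points y of E with y != x.  At an endpoint of E = [a, b] this is the
   one-sided derivative, and values of f outside E play no role. *)
Definition diff_quot (R : realType) (f : R -> R) (x y : R) : R :=
  (f y - f x) / (y - x).

Definition derivable_on (R : realType) (E : set R) (f : R -> R) (x : R) : Prop :=
  cvg (diff_quot f x y @[y --> within E x^']).

Definition derive_on (R : realType) (E : set R) (f : R -> R) (x : R) : R :=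
  lim (diff_quot f x y @[y --> within E x^']).

Definition derive_n_on (R : realType) (E : set R) (k : nat) (f : R -> R) :
  R -> R := iter k (derive_on E) f.

Definition C_on (R : realType) (k : nat) (E : set R) (f : R -> R) : Prop :=
  (forall i : nat, (i < k)%N ->
     forall x : R, E x -> derivable_on E (derive_n_on E i f) x) /\
  (forall i : nat, (i <= k)%N -> {within E, continuous (derive_n_on E i f)}).

(* These are attained extrema; when no minimum (maximum) is attained, the
   value is an unspecified real number. *)
Definition min_on (R : realType) (E : set R) (f : R -> R) : R :=
  get [set m | (f @` E) m /\ lbound (f @` E) m].

Definition max_on (R : realType) (E : set R) (f : R -> R) : R :=
  get [set m | (f @` E) m /\ ubound (f @` E) m].

Definition m_ (R : realType) (g : R -> R) (E : set R) : R :=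
  min_on E (derive_n_on E 2 g).

Definition M_ (R : realType) (g : R -> R) (E : set R) : R :=
  max_on E (derive_n_on E 2 g).

Definition Jensen (R : realType) (n : nat) (p x : 'I_n -> R) (f : R -> R) : R :=
  \sum_(i < n) p i * f (x i) - f (\sum_(i < n) p i * x i).

(* Main.v *)
Require Import Defs.
From HB Require Import structures.
From mathcomp Require Import all_boot all_order all_algebra.
From mathcomp Require Import all_classical all_reals all_analysis.
From mathcomp Require Import ring lra.

Set Implicit Arguments.
Unset Strict Implicit.
Unset Printing Implicit Defensive.

Import Order.TTheory GRing.Theory Num.Theory.
Import numFieldNormedType.Exports.

Local Open Scope classical_set_scope.
Local Open Scope ring_scope.

(** The estimate is Jensen's inequality for the two functions
    [g - (m / 2) t ^ 2] and [(M / 2) t ^ 2 - g], where [m] and [M] are the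
    extrema of [g''] on [[a, b]]: both have a nonnegative second derivative,
    hence are convex, and the Jensen functional is linear in its function
    argument ([Jensen_affine_sqr]), so the two nonnegative Jensen functionals
    are exactly the two differences to be signed.

    Jensen's inequality ([Jensen_ge0]) is obtained by averaging the bound of
    the function from below by its tangent at the barycentre
    ([tangent_le]).  The tangent bound uses the mean value theorem for the
    function, and for its derivative to know that this derivative is
    nondecreasing.  Since the mean value theorem needs derivatives only at
    interior points, the derivatives relative to [[a, b]] enter through
    [is_derive_derive_on], which identifies them with ordinary derivatives
    there; at the endpoints continuity suffices. *)

(** Near an interior point of [E] the punctured neighbourhoods within [E] are
    the ordinary ones, and the difference quotient in the variable [y] becomes
    the one in the increment [h] by the translation [y = h + x]. *)
Lemma is_derive_derive_on (R : realType) (E : set R) (f : R -> R) (x : R) :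
  E° x -> derivable_on E f x -> is_derive x 1 f (derive_on E f x).
Proof.
move=> Ex dfx.
have quot_cvg : h^-1 *: ((f \o shift x) (h *: 1) - f x) @[h --> 0^']
    --> derive_on E f x.
  have incr_cvg : h + x @[h --> 0^'] --> within E x^'.
    move=> A xA.
    have {}xA : \forall y \near x, y != x -> A y.
      have {}xA : \forall y \near x, y != x -> E y -> A y by exact: xA.
      by apply: filterS2 xA Ex => y yA Ey yx; exact: yA.
    have : \forall h \near 0, h + x != x -> A (h + x).
      move: xA; rewrite (near_shift 0 x) subr0; exact.
    by apply: filterS => h + h0; apply; rewrite -subr_eq0 addrK.
  have := cvg_comp _ _ incr_cvg dfx; apply: cvg_trans; apply: near_eq_cvg.
  near=> h.
  by rewrite /diff_quot /= addrK /GRing.scale /= mulr1 mulrC.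
apply: DeriveDef; first by apply/cvg_ex; exists (derive_on E f x).
exact: (cvg_lim _ quot_cvg).
Unshelve. all: by end_near. Qed.

(** The mean value theorem gives [h t - h s = h1 c * (t - s)] with [c] between
    [s] and [t], and applied to [h1] it shows that [h1 c - h1 s] has the sign
    of [t - s]. *)
Lemma tangent_le (R : realType) (a b : R) (h h1 h2 : R -> R) :
  {within `[a, b], continuous h} -> {within `[a, b], continuous h1} ->
  (forall t, t \in `]a, b[%R -> is_derive t 1 h (h1 t)) ->
  (forall t, t \in `]a, b[%R -> is_derive t 1 h1 (h2 t)) ->
  (forall t, t \in `]a, b[%R -> 0 <= h2 t) ->
  {in `[a, b]%R &, forall s t, h s + h1 s * (t - s) <= h t}.
Proof.
move=> hc h1c dh dh1 h2_ge0.
have incr : {in `[a, b]%R &, {homo h1 : s t / s <= t}}.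
  apply: ger0_derive1_le_cc h1c => t tab; have dt := dh1 t tab.
    exact: ex_derive.
  by rewrite derive1E derive_val h2_ge0.
have mvt u v : u \in `[a, b]%R -> v \in `[a, b]%R -> u < v ->
    exists2 c, (u <= c <= v) && (c \in `[a, b]%R) & h v - h u = h1 c * (v - u).
  rewrite !in_itv /= => /andP[au _] /andP[_ vb] uv.
  have duv t : t \in `]u, v[%R -> is_derive t 1 h (h1 t).
    rewrite in_itv /= => /andP[ut tv]; apply: dh.
    by rewrite in_itv /= (le_lt_trans au ut) (lt_le_trans tv vb).
  have huv : {within `[u, v], continuous h}.
    apply: continuous_subspaceW hc => t /=; rewrite !in_itv /= => /andP[ut tv].
    by rewrite (le_trans au ut) (le_trans tv vb).
  have [c + eq_c] := MVT uv duv huv.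
  rewrite in_itv /= => /andP[/ltW uc /ltW cv]; exists c => //.
  by rewrite uc cv in_itv /= (le_trans au uc) (le_trans cv vb).
move=> s t sab tab; have [st|ts|->] := ltgtP s t; last by rewrite subrr; lra.
- have [c /andP[/andP[sc _] cab] eq_c] := mvt s t sab tab st.
  have := incr s c sab cab sc; nra.
- have [c /andP[/andP[_ cs] cab] eq_c] := mvt t s tab sab ts.
  have := incr c s cab sab cs; nra.
Qed.

Lemma barycentre_itv (R : realType) (a b : R) (n : nat) (x p : 'I_n -> R) :
  (forall i, x i \in `[a, b]%R) -> (forall i, 0 <= p i) ->
  \sum_(i < n) p i = 1 -> \sum_(i < n) p i * x i \in `[a, b]%R.
Proof.
move=> xab p_ge0 p1; rewrite in_itv /=.
rewrite -[a]mul1r -[b]mul1r -p1 !mulr_suml; apply/andP; split;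
  by apply: ler_sum => i _; rewrite ler_wpM2l //;
     have := xab i; rewrite in_itv /= => /andP[].
Qed.

(** Averaging the tangent bound at the barycentre [c] with the weights [p]
    makes the linear term vanish. *)
Lemma Jensen_ge0 (R : realType) (a b : R) (h h1 h2 : R -> R) (n : nat)
    (x p : 'I_n -> R) :
  {within `[a, b], continuous h} -> {within `[a, b], continuous h1} ->
  (forall t, t \in `]a, b[%R -> is_derive t 1 h (h1 t)) ->
  (forall t, t \in `]a, b[%R -> is_derive t 1 h1 (h2 t)) ->
  (forall t, t \in `]a, b[%R -> 0 <= h2 t) ->
  (forall i, x i \in `[a, b]%R) -> (forall i, 0 <= p i) ->
  \sum_(i < n) p i = 1 -> 0 <= Jensen p x h.
Proof.
move=> hc h1c dh dh1 h2_ge0 xab p_ge0 p1.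
have := barycentre_itv xab p_ge0 p1; rewrite /Jensen.
set c := \sum_(i < n) p i * x i => cab; rewrite subr_ge0.
have -> : h c = \sum_(i < n) p i * (h c + h1 c * (x i - c)).
  under eq_bigr => i _ do rewrite mulrDr mulrCA.
  rewrite big_split -mulr_suml -mulr_sumr p1 mul1r /=.
  under [X in _ + _ * X]eq_bigr => i _ do rewrite mulrBr.
  by rewrite sumrB -mulr_suml p1 mul1r subrr mulr0 addr0.
apply: ler_sum => i _; rewrite ler_wpM2l //.
exact: (tangent_le hc h1c dh dh1 h2_ge0).
Qed.

Lemma Jensen_affine_sqr (R : realType) (n : nat) (x p : 'I_n -> R)
    (f : R -> R) (u v : R) :
  Jensen p x (fun t => u * f t + v * t ^+ 2) =
  u * Jensen p x f + v * Jensen p x (fun t => t ^+ 2).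
Proof.
rewrite /Jensen; under eq_bigr => i _ do rewrite mulrDr (mulrCA _ u) (mulrCA _ v).
rewrite big_split /= -!mulr_sumr; ring.
Qed.

(** Taking [u = 1] and [v = - m / 2] gives the lower half of the estimate, and
    [u = -1] and [v = M / 2] the upper half. *)
Lemma Jensen_affine_sqr_ge0 (R : realType) (a b : R) (g : R -> R) (n : nat)
    (x p : 'I_n -> R) (u v : R) :
  let E : set R := [set t | t \in `[a, b]] in
  C_on 2 E g ->
  (forall t, E t -> 0 <= u * derive_n_on E 2 g t + v *+ 2) ->
  (forall i, E (x i)) -> (forall i, 0 <= p i) -> \sum_(i < n) p i = 1 ->
  0 <= u * Jensen p x g + v * Jensen p x (fun t => t ^+ 2).
Proof.
move=> E [g_der g_cont] h2_ge0 xE p_ge0 p1; rewrite -Jensen_affine_sqr.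
have subE t : t \in `]a, b[%R -> E t.
  by rewrite /E /= !in_itv /= => /andP[/ltW -> /ltW ->].
have dgn i t : (i < 2)%N -> t \in `]a, b[%R ->
    is_derive t 1 (derive_n_on E i g) (derive_n_on E i.+1 g t).
  move=> i2 tab; apply: is_derive_derive_on; last exact/g_der/subE.
  have -> : E = `[a, b]%classic by [].
  by rewrite interior_itv.
apply: (@Jensen_ge0 R a b _ (fun t => u * derive_n_on E 1 g t + (v *+ 2) * t)
          (fun t => u * derive_n_on E 2 g t + v *+ 2)) => //.
- move=> t; apply: cvgD.
    by apply: cvgM; [exact: cvg_cst|exact: (g_cont 0%N)].
  apply: cvgM; first exact: cvg_cst.
  have sqr_cont : {within `[a, b], continuous (fun s : R => s ^+ 2)}.
    by apply: continuous_subspaceT => s; exact: exprn_continuous.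
  exact: sqr_cont.
- move=> t; apply: cvgD.
    by apply: cvgM; [exact: cvg_cst|exact: (g_cont 1%N)].
  apply: cvgM; first exact: cvg_cst.
  have id_cont : {within `[a, b], continuous (@id R)}.
    by apply: continuous_subspaceT => s; exact: cvg_id.
  exact: id_cont.
- move=> t tab; have dg : is_derive t 1 g (derive_n_on E 1 g t) := dgn 0%N t isT tab.
  apply: is_derive_eq; rewrite /GRing.scale /=; ring.
- move=> t tab; have dg := dgn 1%N t isT tab.
  apply: is_derive_eq; rewrite /GRing.scale /=; ring.
- by move=> t /subE; exact: h2_ge0.
Qed.

Lemma min_on_le (R : realType) (a b : R) (f : R -> R) :
  a <= b -> {within `[a, b], continuous f} ->
  {in `[a, b]%R, forall t, min_on [set` `[a, b]%R] f <= f t}.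
Proof.
move=> ab fc t tab; have [c cab c_min] := EVT_min ab fc.
have [] : [set m | (f @` `[a, b]) m /\ lbound (f @` `[a, b]) m]
    (min_on [set` `[a, b]%R] f).
  apply: getPex; exists (f c); split; first by exists c.
  by move=> _ [s sab <-]; exact: c_min.
by move=> _; apply; exists t.
Qed.

Lemma max_on_ge (R : realType) (a b : R) (f : R -> R) :
  a <= b -> {within `[a, b], continuous f} ->
  {in `[a, b]%R, forall t, f t <= max_on [set` `[a, b]%R] f}.
Proof.
move=> ab fc t tab; have [c cab c_max] := EVT_max ab fc.
have [] : [set m | (f @` `[a, b]) m /\ ubound (f @` `[a, b]) m]
    (max_on [set` `[a, b]%R] f).
  apply: getPex; exists (f c); split; first by exists c.
  by move=> _ [s sab <-]; exact: c_max.
by move=> _; apply; exists t.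
Qed.

Theorem theorem2p11 (R : realType) (a b : R) (g : R -> R) (n : nat)
    (x p : 'I_n -> R) :
  let E : set R := [set t | t \in `[a, b]] in
  a < b ->
  C_on 2 E g ->
  (forall i, E (x i)) ->
  (forall i, 0 < p i) ->
  \sum_(i < n) p i = 1 ->
  2^-1 * m_ g E * Jensen p x (fun t => t ^+ 2) <= Jensen p x g /\
  Jensen p x g <= 2^-1 * M_ g E * Jensen p x (fun t => t ^+ 2).
Proof.
move=> E ab gC xE p_gt0 p1.
have p_ge0 i : 0 <= p i := ltW (p_gt0 i).
have g2c : {within `[a, b], continuous (derive_n_on E 2 g)} := gC.2 2%N isT.
split.
- have m_le t : E t -> 0 <= 1 * derive_n_on E 2 g t + (- (2^-1 * m_ g E)) *+ 2.
    move=> tE; have : m_ g E <= derive_n_on E 2 g t := min_on_le (ltW ab) g2c tE.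
    lra.
  have := Jensen_affine_sqr_ge0 gC m_le xE p_ge0 p1; lra.
- have M_ge t : E t -> 0 <= -1 * derive_n_on E 2 g t + (2^-1 * M_ g E) *+ 2.
    move=> tE; have : derive_n_on E 2 g t <= M_ g E := max_on_ge (ltW ab) g2c tE.
    lra.
  have := Jensen_affine_sqr_ge0 gC M_ge xE p_ge0 p1; lra.
Qed.
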